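(* For all integers $m,k\ge 0$, \begin{align*} \zeta(\bar 1,\{1\}_m,\bar 1,\bar 1,\{1\}_k)=&\frac{(-1)^k}{(m+1)!(k+1)!}\Big\{(k+1)(\ln 2)^{m+1}I(k)-(m+k+2)I(m+k+1)\Big\}\\ &-\sum_{i=1}^{m}\frac{(\ln 2)^i}{i!}\zeta(\bar 1,\{1\}_{m-i},\bar 1,\bar 1,\{1\}_k), \end{align*} where for integers $k\ge1$, $I(k):=\int_0^1\frac{\ln^k(1+x)\ln(1-x)}{1+x}\,dx$, and $I(0):=\frac{\ln^2(2)-\zeta(2)}{2}$.
   Context: For nonzero integers $s_1,\dots,s_k$, with $\operatorname{sgn}(s)=1$ if $s>0$ and $-1$ if $s<0$, the multiple zeta value is $\zeta(s_1,\dots,s_k)=\sum_{n_1>n_2>\cdots>n_k\ge 1}\prod_{j=1}^k n_j^{-|s_j|}\operatorname{sgn}(s_j)^{n_j}$. A barred entry $\bar p$ denotes the negative entry $-p$. The notation $\{1\}_d$ means the entry $1$ repeated $d$ times ($d=0$ means no entries). $\zeta(2)=\sum_{n\ge1}n^{-2}$. *)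

(* Defs.v *)
From Stdlib Require Import Reals ZArith List.
From Coquelicot Require Import Coquelicot.
Open Scope R_scope.

Definition mzv_term (s : Z) (n : nat) : R :=
  (if (0 <? s)%Z then 1 else (-1) ^ n) / (INR n) ^ (Z.abs_nat s).

Fixpoint mzv_trunc (s : list Z) (N : nat) : R :=
  match s with
  | nil => 1
  | s1 :: t =>
      sum_n_m (fun n => mzv_term s1 n * mzv_trunc t (n - 1)%nat) 1 N
  end.

Definition mzv (s : list Z) : R := real (Lim_seq (fun N => mzv_trunc s N)).

Definition zeta2 : R := mzv (2%Z :: nil).

Definition Iint (k : nat) : R :=
  match k with
  | O => (ln 2 ^ 2 - zeta2) / 2
  | S _ => RInt_gen (fun x => ln (1 + x) ^ k * ln (1 - x) / (1 + x))
             (at_point 0) (at_left 1)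
  end.

Definition arg_mk (m k : nat) : list Z :=
  (-1)%Z :: repeat 1%Z m ++ (-1)%Z :: (-1)%Z :: repeat 1%Z k.

(* Main.v *)
Require Import Defs.
From Stdlib Require Import Reals ZArith List.
From Coquelicot Require Import Coquelicot.
From Stdlib Require Import Lra Lia.
Open Scope R_scope.

(** For a list [s] of entries [1] and [-1] let [F_s(x) = sum_(n_1 > ... > n_k)
    x^(n_1) prod_j sgn(s_j)^(n_j) / n_j].  Then [F_(1,t)' = F_t / (1 - x)] and
    [F_(-1,t)(x) = F_(1,t)(- x)], so each [F_s] is an iterated integral of
    logarithms.  With [u = ln (1 + x)], the sum over [i <= m] of
    [u^i / i! * F_(-1,{1}_(m-i),-1,-1,{1}_k)(x)] has a telescoping derivative,
    which yields a version of the identity for every [|x| < 1], with [ln 2]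
    replaced by [u] and the integrals taken over [[0, x]].  Abel's theorem allows
    [x -> 1]: the series [F_(-1,t)(1)] converges because its terms alternate and
    have bounded variation.  The constant [I(0)] comes from
    [zeta(-1)^2 = 2 zeta(-1,-1) + zeta(2)]. *)

(** * Coefficients of the generating series and their growth *)

Definition unit_entries (s : list Z) : Prop :=
  List.Forall (fun z => z = 1%Z \/ z = (-1)%Z) s.

(** These are the power series coefficients of [F_s]: the terms with [n_1 = n] are collected. For
    the empty list this is the constant series [1], so that the partial sums are the truncations for
    every list. *)
Definition coef (s : list Z) (n : nat) : R :=
  match s, n with
  | nil, O => 1
  | nil, S _ => 0
  | _ :: _, O => 0
  | z :: t, S p => mzv_term z (S p) * mzv_trunc t p
  end.

Lemma sum_n_coef (s : list Z) (n : nat) : sum_n (coef s) n = mzv_trunc s n.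
Proof.
  destruct s as [|z t].
  - induction n as [|n IH].
    + now rewrite sum_O.
    + rewrite sum_Sn, IH. simpl. unfold plus; simpl. ring.
  - change (sum_n (coef (z :: t)) n = sum_n_m (fun i => mzv_term z i * mzv_trunc t (i - 1)%nat) 1 n).
    unfold sum_n. rewrite sum_Sn_m by lia.
    unfold plus; simpl. rewrite Rplus_0_l.
    apply sum_n_m_ext_loc. intros i Hi.
    destruct i as [|i]; [lia|]. simpl. now rewrite Nat.sub_0_r.
Qed.

Lemma mzv_term_one (n : nat) : mzv_term 1 n = / INR n.
Proof.
  change (mzv_term 1 n) with (1 / INR n ^ 1).
  now rewrite pow_1, Rdiv_1_l.
Qed.

Lemma mzv_term_minus_one (n : nat) : mzv_term (-1) n = (-1) ^ n / INR n.
Proof. change (mzv_term (-1) n) with ((-1) ^ n / INR n ^ 1). now rewrite pow_1. Qed.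

Lemma Rabs_mzv_term (z : Z) (n : nat) :
  z = 1%Z \/ z = (-1)%Z -> Rabs (mzv_term z (S n)) = / INR (S n).
Proof.
  assert (Hp := lt_0_INR (S n) (Nat.lt_0_succ n)).
  assert (Hi : 0 < / INR (S n)) by now apply Rinv_0_lt_compat.
  intros [-> | ->].
  - rewrite mzv_term_one. apply Rabs_pos_eq. lra.
  - rewrite mzv_term_minus_one. unfold Rdiv.
    rewrite Rabs_mult, pow_1_abs, Rmult_1_l. apply Rabs_pos_eq. lra.
Qed.

Lemma sqrt_succ_pos (n : nat) : 0 < sqrt (INR (S n)).
Proof. apply sqrt_lt_R0, lt_0_INR; lia. Qed.

Lemma sqr_sqrt_succ (n : nat) : sqrt (INR (S n)) * sqrt (INR (S n)) = INR (S n).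
Proof. apply sqrt_sqrt, pos_INR. Qed.

Lemma sqr_sqrt_succ_succ (n : nat) :
  sqrt (INR (S (S n))) * sqrt (INR (S (S n))) = INR (S n) + 1.
Proof. rewrite sqr_sqrt_succ. apply S_INR. Qed.

Lemma sqrt_succ_lt (n : nat) : sqrt (INR (S n)) < sqrt (INR (S (S n))).
Proof. apply sqrt_lt_1; try apply pos_INR. apply lt_INR; lia. Qed.

(* The true growth is a power of [ln n]; any bound [b n] with [b n / n^2] summable
   would do, and with [sqrt] both inductions telescope. *)
Lemma mzv_trunc_bound (s : list Z) (n : nat) :
  unit_entries s -> Rabs (mzv_trunc s n) <= 4 ^ length s * sqrt (INR (S n)).
Proof.
  revert n; induction s as [|z t IH]; intros n Hs.
  - simpl mzv_trunc; simpl length. rewrite Rabs_R1, pow_O, Rmult_1_l, <- sqrt_1.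
    apply sqrt_le_1; try lra; try apply pos_INR.
    apply (le_INR 1); lia.
  - inversion Hs as [|? ? Hz Ht]; subst.
    rewrite <- sum_n_coef.
    change (4 ^ length (z :: t)) with (4 * 4 ^ length t).
    assert (H4 : 0 < 4 ^ length t) by (apply pow_lt; lra).
    induction n as [|n IHn].
    + rewrite sum_O. simpl coef. rewrite Rabs_R0.
      assert (H := sqrt_succ_pos 0). nra.
    + rewrite sum_Sn. unfold plus; simpl AbelianGroup.sort.
      eapply Rle_trans; [apply Rabs_triang|].
      apply Rle_trans with (4 * 4 ^ length t * sqrt (INR (S n))
        + / INR (S n) * (4 ^ length t * sqrt (INR (S n)))).
      { apply Rplus_le_compat; [exact IHn|].
        simpl coef. rewrite Rabs_mult, Rabs_mzv_term by exact Hz.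
        apply Rmult_le_compat_l; [|now apply IH].
        apply Rlt_le, Rinv_0_lt_compat, lt_0_INR; lia. }
      rewrite <- (sqr_sqrt_succ n) at 2.
      assert (Ha := sqrt_succ_pos n). assert (Hab := sqrt_succ_lt n).
      assert (Haa := sqr_sqrt_succ n). assert (Hbb := sqr_sqrt_succ_succ n).
      set (a := sqrt (INR (S n))) in *. set (b := sqrt (INR (S (S n)))) in *.
      assert (H1 : 1 <= INR (S n)) by (apply (le_INR 1); lia).
      assert (Hb3 : b <= 3 * a).
      { apply Rsqr_incr_0; unfold Rsqr; lra. }
      replace (/ (a * a) * (4 ^ length t * a)) with (4 ^ length t * / a) by (field; lra).
      (* Since [(b - a) * (b + a) = 1], this amounts to [a + b <= 4 * a], that is [b <= 3 * a]. It
         is the source of the factor [4] per entry. *)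
      assert (H : / a <= 4 * (b - a)).
      { apply Rmult_le_reg_l with a; [lra|]. rewrite Rinv_r by lra.
        assert (0 <= (b - a) * (3 * a - b)) by (apply Rmult_le_pos; lra). nra. }
      nra.
Qed.

(** The factor [1 / n] of the leading entry turns the square root growth of the truncation into
    square root decay. The extra factor [4] of that entry absorbs the index shift between the two
    square roots. *)
Lemma coef_bound (s : list Z) (n : nat) :
  unit_entries s -> Rabs (coef s n) <= 4 ^ length s / sqrt (INR (S n)).
Proof.
  intros Hs. assert (H4 : 0 < 4 ^ length s) by (apply pow_lt; lra).
  assert (Ha := sqrt_succ_pos n).
  assert (Hr : 0 < / sqrt (INR (S n))) by now apply Rinv_0_lt_compat.
  destruct s as [|z t]; destruct n as [|n]; simpl coef.
  - simpl. rewrite sqrt_1, Rabs_R1. lra.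
  - rewrite Rabs_R0. unfold Rdiv. nra.
  - rewrite Rabs_R0. unfold Rdiv. nra.
  - inversion Hs as [|? ? Hz Ht]; subst.
    rewrite Rabs_mult, Rabs_mzv_term by exact Hz.
    apply Rle_trans with (/ INR (S n) * (4 ^ length t * sqrt (INR (S n)))).
    { apply Rmult_le_compat_l; [|now apply mzv_trunc_bound].
      apply Rlt_le, Rinv_0_lt_compat, lt_0_INR; lia. }
    change (4 ^ length (z :: t)) with (4 * 4 ^ length t) in *.
    rewrite <- (sqr_sqrt_succ n) at 1.
    assert (Hc := sqrt_succ_pos n). assert (Hab := sqrt_succ_lt n).
    assert (Haa := sqr_sqrt_succ n). assert (Hbb := sqr_sqrt_succ_succ n).
    assert (H1 : 1 <= INR (S n)) by (apply (le_INR 1); lia).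
    set (a := sqrt (INR (S n))) in *. set (b := sqrt (INR (S (S n)))) in *.
    replace (/ (a * a) * (4 ^ length t * a)) with (4 ^ length t * / a) by (field; lra).
    unfold Rdiv. replace (4 * 4 ^ length t * / b) with (4 ^ length t * (4 * / b)) by ring.
    apply Rmult_le_compat_l; [lra|].
    apply Rmult_le_reg_l with (a * b); [nra|].
    replace (a * b * / a) with b by (field; lra).
    replace (a * b * (4 * / b)) with (4 * a) by (field; lra).
    nra.
Qed.

Lemma coef_bound_length (s : list Z) (n : nat) :
  unit_entries s -> Rabs (coef s n) <= 4 ^ length s.
Proof.
  intros Hs. eapply Rle_trans; [now apply coef_bound|].
  assert (H4 : 0 < 4 ^ length s) by (apply pow_lt; lra).
  assert (H1 : 1 <= sqrt (INR (S n))).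
  { rewrite <- sqrt_1. apply sqrt_le_1; try lra; try apply pos_INR.
    apply (le_INR 1); lia. }
  apply Rmult_le_reg_r with (sqrt (INR (S n))); [lra|].
  unfold Rdiv. rewrite Rmult_assoc, Rinv_l by lra. nra.
Qed.

Lemma CV_radius_ge_1_of_bounded (a : nat -> R) (M : R) :
  (forall n, Rabs (a n) <= M) -> Rbar_le 1 (CV_radius a).
Proof.
  intros Ha. apply (proj1 (CV_radius_bounded a)).
  exists M. intros n. now rewrite pow1, Rmult_1_r.
Qed.

Lemma CV_radius_coef (s : list Z) (x : R) :
  unit_entries s -> Rabs x < 1 -> Rbar_lt (Rabs x) (CV_radius (coef s)).
Proof.
  intros Hs Hx. apply Rbar_lt_le_trans with (Finite 1); [exact Hx|].
  apply CV_radius_ge_1_of_bounded with (4 ^ length s).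
  intros n. now apply coef_bound_length.
Qed.

(** * Convergence at 1 of series with leading entry -1 *)

Lemma ex_series_telescope (u : nat -> R) (l : R) :
  is_lim_seq u l -> ex_series (fun n => u n - u (S n)).
Proof.
  intros Hu. exists (u O - l).
  change (is_lim_seq (sum_n (fun n => u n - u (S n))) (Finite (u O - l))).
  apply (is_lim_seq_ext (fun n => u O - u (S n))).
  - intros n. induction n as [|n IH].
    + now rewrite sum_O.
    + rewrite sum_Sn, <- IH. unfold plus; simpl. ring.
  - apply (is_lim_seq_minus' (fun _ => u O)); [apply is_lim_seq_const|].
    now apply is_lim_seq_incr_1 in Hu.
Qed.

(** A substitute for the Leibniz criterion: the sequences to which it is applied need not be
    monotone, since the inner truncation may itself oscillate. *)
Lemma ex_series_alternating_BV (c : nat -> R) :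
  is_lim_seq c 0 -> ex_series (fun n => Rabs (c n - c (S n))) ->
  ex_series (fun n => (-1) ^ n * c n).
Proof.
  intros Hc Hv.
  assert (Hd : ex_series (fun n => (-1) ^ n * (c n - c (S n)))).
  { apply ex_series_Rabs. eapply ex_series_ext; [|exact Hv].
    intros n. simpl. now rewrite Rabs_mult, pow_1_abs, Rmult_1_l. }
  destruct Hd as [l Hl].
  exists ((c O + l) / 2).
  change (is_lim_seq (sum_n (fun n => (-1) ^ n * c n)) (Finite ((c O + l) / 2))).
  assert (H0 : is_lim_seq (fun n => (-1) ^ n * c (S n)) 0).
  { apply is_lim_seq_abs_0. eapply is_lim_seq_ext;
      [|apply is_lim_seq_abs_0, is_lim_seq_incr_1 in Hc; exact Hc].
    intros n. simpl. now rewrite Rabs_mult, pow_1_abs, Rmult_1_l. }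
  (* Averaging the sum with its shift by one index expresses the partial sums through the absolutely
     convergent sum of differences and a boundary term that vanishes. *)
  apply (is_lim_seq_ext (fun n =>
    / 2 * (c O + sum_n (fun n => (-1) ^ n * (c n - c (S n))) n + (-1) ^ n * c (S n)))).
  - intros n. induction n as [|n IH].
    + rewrite !sum_O. simpl. lra.
    + rewrite !sum_Sn, <- IH. unfold plus; simpl. lra.
  - replace (Finite ((c O + l) / 2)) with (Rbar_mult (/ 2) (c O + l + 0))
      by (simpl; f_equal; field).
    apply is_lim_seq_scal_l.
    apply is_lim_seq_plus'; [|exact H0].
    apply is_lim_seq_plus'; [apply is_lim_seq_const|exact Hl].
Qed.

Lemma is_lim_seq_inv_sqrt (C : R) : is_lim_seq (fun n => C * / sqrt (INR (S n))) 0.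
Proof.
  replace (Finite 0) with (Rbar_mult C 0) by (simpl; f_equal; ring).
  apply is_lim_seq_scal_l.
  replace (Finite 0) with (Rbar_inv p_infty) by reflexivity.
  apply is_lim_seq_inv; [|discriminate].
  apply (filterlim_comp _ _ _ (fun n => INR (S n)) sqrt eventually (Rbar_locally p_infty)).
  - apply (proj1 (is_lim_seq_incr_1 INR p_infty)), is_lim_seq_INR.
  - apply filterlim_sqrt_p.
Qed.

(** Up to a global sign and an index shift, the series is alternating with
    [c n = mzv_trunc t n / INR (S n)]. The bound on truncations gives both [c n -> 0] and a
    telescoping majorant for the variation of [c]. *)
Lemma ex_series_coef (t : list Z) :
  unit_entries t -> ex_series (coef ((-1)%Z :: t)).
Proof.
  intros Ht.
  assert (H4 : 0 < 4 ^ length t) by (apply pow_lt; lra).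
  apply ex_series_incr_1.
  apply (ex_series_ext (fun n => opp ((-1) ^ n * (mzv_trunc t n / INR (S n))))).
  { intros n. change (- ((-1) ^ n * (mzv_trunc t n / INR (S n)))
      = mzv_term (-1) (S n) * mzv_trunc t n).
    rewrite mzv_term_minus_one, <- tech_pow_Rmult. field. apply not_0_INR; lia. }
  apply (ex_series_opp (fun n => (-1) ^ n * (mzv_trunc t n / INR (S n)))).
  apply ex_series_alternating_BV.
  - apply is_lim_seq_abs_0.
    apply is_lim_seq_le_le with (fun _ => 0) (fun n => 4 ^ length t * / sqrt (INR (S n)));
      [|apply is_lim_seq_const|apply is_lim_seq_inv_sqrt].
    intros n. split; [apply Rabs_pos|].
    assert (Hp := lt_0_INR (S n) (Nat.lt_0_succ n)).
    rewrite Rabs_div, (Rabs_pos_eq (INR (S n))) by lra.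
    assert (H := mzv_trunc_bound t n Ht).
    assert (Haa := sqr_sqrt_succ n). assert (Ha := sqrt_succ_pos n).
    set (a := sqrt (INR (S n))) in *. rewrite <- Haa.
    replace (4 ^ length t * / a) with ((4 ^ length t * a) / (a * a)) by (field; lra).
    apply Rmult_le_compat_r; [|exact H].
    apply Rlt_le, Rinv_0_lt_compat; nra.
  - apply (@ex_series_le _ R_CompleteNormedModule _
      (fun n => 8 * 4 ^ length t * / sqrt (INR (S n)) - 8 * 4 ^ length t * / sqrt (INR (S (S n)))));
      [|apply (ex_series_telescope _ _ (is_lim_seq_inv_sqrt _))].
    intros n. unfold norm; simpl. rewrite Rabs_Rabsolu.
    change (Rabs (mzv_trunc t n / INR (S n) - mzv_trunc t (S n) / INR (S (S n)))
      <= 8 * 4 ^ length t * / sqrt (INR (S n))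
         - 8 * 4 ^ length t * / sqrt (INR (S (S n)))).
    rewrite <- (sum_n_coef t (S n)), sum_Sn, (sum_n_coef t n).
    change (plus (mzv_trunc t n) (coef t (S n))) with (mzv_trunc t n + coef t (S n)).
    assert (HT := mzv_trunc_bound t n Ht).
    assert (HC : Rabs (coef t (S n)) <= 4 ^ length t / sqrt (INR (S n))).
    { destruct t as [|z t'].
      - simpl coef. rewrite Rabs_R0. apply Rlt_le, Rdiv_lt_0_compat; [lra|apply sqrt_succ_pos].
      - eapply Rle_trans; [now apply coef_bound|].
        apply Rmult_le_compat_l; [lra|].
        apply Rinv_le_contravar; [apply sqrt_succ_pos|apply Rlt_le, sqrt_succ_lt]. }
    assert (Ha := sqrt_succ_pos n). assert (Hab := sqrt_succ_lt n).
    assert (Haa := sqr_sqrt_succ n). assert (Hbb := sqr_sqrt_succ (S n)).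
    assert (Hn : INR (S (S n)) = INR (S n) + 1) by apply S_INR.
    set (a := sqrt (INR (S n))) in *. set (b := sqrt (INR (S (S n)))) in *.
    rewrite <- Haa, <- Hbb. rewrite <- Haa, <- Hbb in Hn.
    set (C := 4 ^ length t) in *. set (T := mzv_trunc t n) in *. set (d := coef t (S n)) in *.
    (* The variation has two sources, the change of denominator and the new summand [d] of the
       truncation. Apart from the common factor [/ (b * b)], each is at most [C / a]. *)
    replace (T / (a * a) - (T + d) / (b * b))
      with ((T * ((b * b) - (a * a)) / (a * a) - d) * / (b * b)) by (field; lra).
    replace (b * b - a * a) with 1 by lra.
    rewrite Rabs_mult, (Rabs_pos_eq (/ (b * b))) by (apply Rlt_le, Rinv_0_lt_compat; nra).
    apply Rle_trans with ((2 * C * / a) * / (b * b)).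
    + apply Rmult_le_compat_r; [apply Rlt_le, Rinv_0_lt_compat; nra|].
      eapply Rle_trans; [apply Rabs_triang|].
      rewrite Rabs_Ropp. replace (2 * C * / a) with (C / a + C / a) by (field; lra).
      apply Rplus_le_compat; [|exact HC].
      rewrite Rmult_1_r, Rabs_div, (Rabs_pos_eq (a * a)) by nra.
      replace (C / a) with (C * a / (a * a)) by (field; lra).
      apply Rmult_le_compat_r; [|exact HT].
      apply Rlt_le, Rinv_0_lt_compat; nra.
    (* The last factor is at least [1], because [2 * b * (b - a) >= (b + a) * (b - a) = 1]. *)
    + replace (8 * C * / a - 8 * C * / b)
        with (2 * C * / a * / (b * b) * (4 * b * (b - a))) by (field; lra).
      rewrite <- (Rmult_1_r (2 * C * / a * / (b * b))) at 1.
      apply Rmult_le_compat_l; [|nra].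
      assert (0 < / a) by now apply Rinv_0_lt_compat.
      assert (0 < / (b * b)) by (apply Rinv_0_lt_compat; nra).
      apply Rmult_le_pos; [|lra]. nra.
Qed.

(** * Derivatives of the generating series and Abel's theorem *)

(** The sequence [a] is [sum_n a] minus its shift by one index, and the shift multiplies the series
    by [x]. *)
Lemma PSeries_sum_n (a : nat -> R) (x : R) :
  ex_pseries (sum_n a) x -> PSeries a x = (1 - x) * PSeries (sum_n a) x.
Proof.
  intros Hs.
  transitivity (PSeries (PS_minus (sum_n a) (PS_incr_1 (sum_n a))) x).
  - apply PSeries_ext. intros [|n]; unfold PS_minus, PS_plus, PS_opp, PS_incr_1.
    + rewrite sum_O. unfold plus, opp, zero; simpl. ring.
    + rewrite sum_Sn. unfold plus, opp; simpl. ring.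
  - rewrite PSeries_minus; [|exact Hs|now apply ex_pseries_incr_1].
    rewrite PSeries_incr_1. ring.
Qed.

Lemma PSeries_coef_nil (x : R) : PSeries (coef nil) x = 1.
Proof.
  apply is_series_unique.
  apply (filterlim_ext (fun _ => 1)).
  - intros n. induction n as [|n IH].
    + rewrite sum_O. simpl. ring.
    + rewrite sum_Sn, <- IH. unfold plus; simpl. ring.
  - apply filterlim_const.
Qed.

Lemma PSeries_coef_cons_0 (z : Z) (t : list Z) : PSeries (coef (z :: t)) 0 = 0.
Proof. now rewrite PSeries_0. Qed.

Lemma PSeries_coef_bar (t : list Z) (x : R) :
  PSeries (coef ((-1)%Z :: t)) x = PSeries (coef (1%Z :: t)) (- x).
Proof.
  apply Series_ext. intros [|n]; simpl coef; [ring|].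
  rewrite mzv_term_one, mzv_term_minus_one.
  replace (- x) with (-1 * x) by ring. rewrite Rpow_mult_distr.
  field. apply not_0_INR; lia.
Qed.

(** Differentiation cancels the factor [1 / n] and leaves the truncations of [t], which are the
    partial sums of [coef t]; their generating function is that of [coef t] divided by [1 - x]. *)
Lemma is_derive_coef_one (t : list Z) (x : R) :
  unit_entries t -> Rabs x < 1 ->
  is_derive (PSeries (coef (1%Z :: t))) x (PSeries (coef t) x / (1 - x)).
Proof.
  intros Ht Hx.
  assert (Hs : unit_entries (1%Z :: t)) by (constructor; auto).
  assert (Hr := CV_radius_coef _ x Hs Hx).
  assert (Hd : forall n, PS_derive (coef (1%Z :: t)) n = sum_n (coef t) n).
  { intros n. rewrite sum_n_coef. unfold PS_derive; simpl coef.
    rewrite mzv_term_one. field. apply not_0_INR; lia. }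
  replace (PSeries (coef t) x / (1 - x)) with (PSeries (PS_derive (coef (1%Z :: t))) x);
    [now apply is_derive_PSeries|].
  rewrite (PSeries_ext _ _ _ Hd), (PSeries_sum_n (coef t) x).
  - field. apply Rabs_def2 in Hx. lra.
  - apply (ex_pseries_ext _ _ _ Hd). apply CV_radius_inside.
    now rewrite CV_radius_derive.
Qed.

Lemma is_derive_coef_one_opp (t : list Z) (x : R) :
  unit_entries t -> Rabs x < 1 ->
  is_derive (fun y => PSeries (coef (1%Z :: t)) (- y)) x (- PSeries (coef t) (- x) / (1 + x)).
Proof.
  intros Ht Hx.
  assert (H := is_derive_coef_one t (- x) Ht).
  rewrite Rabs_Ropp in H. specialize (H Hx).
  assert (Hn : is_derive (fun y : R => - y) x (-1)) by (auto_derive; [exact I|ring]).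
  assert (Hc := is_derive_comp _ _ _ _ _ H Hn).
  unfold scal in Hc; simpl in Hc; unfold mult in Hc; simpl in Hc.
  replace (- PSeries (coef t) (- x) / (1 + x))
    with (-1 * (PSeries (coef t) (- x) / (1 - - x))); [exact Hc|].
  apply Rabs_def2 in Hx. field. lra.
Qed.

Lemma is_derive_coef_bar (t : list Z) (x : R) :
  unit_entries t -> Rabs x < 1 ->
  is_derive (PSeries (coef ((-1)%Z :: t))) x (- PSeries (coef t) (- x) / (1 + x)).
Proof.
  intros Ht Hx. eapply is_derive_ext; [|now apply is_derive_coef_one_opp].
  intros y. symmetry. apply PSeries_coef_bar.
Qed.

Lemma PSeries_at_left_1 (a : nat -> R) :
  ex_series a -> filterlim (PSeries a) (at_left 1) (locally (Series a)).
Proof.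
  intros Ha.
  assert (Hp : PSeries a 1 = Series a).
  { apply Series_ext. intros n. now rewrite pow1, Rmult_1_r. }
  rewrite <- Hp.
  (* [Abel] speaks of the boundary of the disc of convergence, so it covers radius exactly 1. A
     larger radius gives plain continuity, and a smaller one contradicts that the terms tend to
     0. *)
  destruct (Rbar_lt_dec 1 (CV_radius a)) as [H1|H1].
  - eapply filterlim_filter_le_1; [apply filter_le_within|].
    apply continuity_pt_filterlim, PSeries_continuity. now rewrite Rabs_R1.
  - destruct (Rbar_lt_dec (CV_radius a) 1) as [H2|H2].
    + exfalso. apply (CV_disk_outside a 1); [now rewrite Rabs_R1|].
      apply (is_lim_seq_ext a); [|now apply ex_series_lim_0].
      intros n. now rewrite pow1, Rmult_1_r.
    + assert (He : CV_radius a = Finite 1).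
      { apply Rbar_le_antisym; now apply Rbar_not_lt_le. }
      assert (HA := Abel a). rewrite He in HA. apply HA; simpl; [lra|exact I|].
      destruct Ha as [l Hl]. exists l.
      eapply is_series_ext; [|exact Hl].
      intros n. rewrite pow_n_pow, pow1. unfold scal; simpl; unfold mult; simpl. ring.
Qed.

Lemma mzv_Series (s : list Z) : mzv s = Series (coef s).
Proof. unfold mzv, Series. f_equal. apply Lim_seq_ext. intros n. now rewrite sum_n_coef. Qed.

Lemma PSeries_coef_bar_at_left_1 (t : list Z) :
  unit_entries t ->
  filterlim (PSeries (coef ((-1)%Z :: t))) (at_left 1) (locally (mzv ((-1)%Z :: t))).
Proof. intros Ht. rewrite mzv_Series. now apply PSeries_at_left_1, ex_series_coef. Qed.

Lemma is_lim_seq_mzv_trunc_bar (t : list Z) :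
  unit_entries t ->
  is_lim_seq (mzv_trunc ((-1)%Z :: t)) (mzv ((-1)%Z :: t)).
Proof.
  intros Ht. rewrite mzv_Series. apply (is_lim_seq_ext _ _ _ (sum_n_coef _)).
  now apply Series_correct, ex_series_coef.
Qed.

(** * Closed forms by comparison of derivatives *)

(** The closed forms below are all verified in this way, so that the work in each is the computation
    of a derivative. *)
Lemma eq_of_is_derive_unit (f g d : R -> R) (x : R) :
  (forall y, Rabs y < 1 -> is_derive f y (d y)) ->
  (forall y, Rabs y < 1 -> is_derive g y (d y)) ->
  f 0 = g 0 -> Rabs x < 1 -> f x = g x.
Proof.
  intros Hf Hg H0 Hx.
  assert (Hd : forall y, Rabs y < 1 -> is_derive (fun y => f y - g y) y zero).
  { intros y Hy.
    assert (H := is_derive_minus f g y _ _ (Hf y Hy) (Hg y Hy)).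
    now rewrite minus_eq_zero in H. }
  apply Rabs_def2 in Hx.
  enough (f x - g x = f 0 - g 0) by lra.
  destruct (Rtotal_order x 0) as [H|[->|H]]; [|reflexivity|symmetry];
    (apply (eq_is_derive (fun y => f y - g y)); [|exact H]);
    intros t Ht; apply Hd, Rabs_def1; lra.
Qed.

Lemma INR_fact_S (k : nat) : INR (fact (S k)) = INR (S k) * INR (fact k).
Proof. now rewrite fact_simpl, mult_INR. Qed.

Lemma is_derive_pow_fact (f : R -> R) (k : nat) (x d : R) :
  is_derive f x d ->
  is_derive (fun y => f y ^ S k / INR (fact (S k))) x (f x ^ k / INR (fact k) * d).
Proof.
  intros Hf.
  assert (Hp := is_derive_pow f (S k) x d Hf).
  assert (Hs := is_derive_scal _ x (/ INR (fact (S k))) _ Hp).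
  replace (f x ^ k / INR (fact k) * d)
    with (/ INR (fact (S k)) * (INR (S k) * d * f x ^ pred (S k))).
  - eapply is_derive_ext; [|exact Hs]. intros y. unfold Rdiv. apply Rmult_comm.
  - rewrite INR_fact_S, Nat.pred_succ. field. split; [apply INR_fact_neq_0|].
    apply not_0_INR; lia.
Qed.

Lemma unit_entries_ones (k : nat) : unit_entries (repeat 1%Z k).
Proof. induction k; constructor; auto. Qed.

Lemma PSeries_coef_ones (k : nat) (x : R) :
  Rabs x < 1 -> PSeries (coef (repeat 1%Z k)) x = (- ln (1 - x)) ^ k / INR (fact k).
Proof.
  revert x; induction k as [|k IH]; intros x Hx.
  - simpl repeat. rewrite PSeries_coef_nil. simpl. field.
  - apply (eq_of_is_derive_unit _ (fun x => (- ln (1 - x)) ^ S k / INR (fact (S k)))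
      (fun x => PSeries (coef (repeat 1%Z k)) x / (1 - x))); [| | |exact Hx].
    + intros y Hy. now apply is_derive_coef_one; [apply unit_entries_ones|].
    + intros y Hy. rewrite IH by exact Hy. apply Rabs_def2 in Hy.
      replace ((- ln (1 - y)) ^ k / INR (fact k) / (1 - y))
        with ((- ln (1 - y)) ^ k / INR (fact k) * / (1 - y)) by reflexivity.
      apply (is_derive_pow_fact (fun x => - ln (1 - x))).
      auto_derive; [lra|]. field. lra.
    + simpl repeat. rewrite PSeries_coef_cons_0, Rminus_0_r, ln_1. simpl pow.
      unfold Rdiv. ring.
Qed.

(** * Logarithmic integrals over [0, x] and the identity for |x| < 1 *)

(** The integrand of [Iint], used for [k = 0] as well, although [Iint 0] is given as a constant. The
    agreement in that case is proved later. *)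
Definition log_kernel (k : nat) (x : R) : R := ln (1 + x) ^ k * ln (1 - x) / (1 + x).

Lemma continuous_log_kernel (k : nat) (x : R) :
  Rabs x < 1 -> continuous (log_kernel k) x.
Proof.
  intros Hx. apply Rabs_def2 in Hx.
  apply (ex_derive_continuous (log_kernel k)).
  unfold log_kernel. auto_derive. repeat split; lra.
Qed.

Lemma ex_RInt_log_kernel (k : nat) (x : R) :
  Rabs x < 1 -> ex_RInt (log_kernel k) 0 x.
Proof.
  intros Hx. apply (@ex_RInt_continuous R_CompleteNormedModule).
  intros z Hz. apply continuous_log_kernel.
  apply Rabs_def2 in Hx. apply Rabs_def1.
  - apply Rle_lt_trans with (1 := proj2 Hz). apply Rmax_lub_lt; lra.
  - apply Rlt_le_trans with (2 := proj1 Hz). apply Rmin_glb_lt; lra.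
Qed.

Lemma is_derive_RInt_log_kernel (k : nat) (x : R) :
  Rabs x < 1 -> is_derive (RInt (log_kernel k) 0) x (log_kernel k x).
Proof.
  intros Hx. apply (@is_derive_RInt R_NormedModule _ _ 0).
  - assert (Hd : 0 < 1 - Rabs x) by lra.
    exists (mkposreal _ Hd). intros y Hy.
    apply (@RInt_correct R_CompleteNormedModule), ex_RInt_log_kernel.
    unfold ball in Hy; simpl in Hy; unfold AbsRing_ball, abs, minus, plus, opp in Hy; simpl in Hy.
    replace y with ((y + - x) + x) by ring.
    eapply Rle_lt_trans; [apply Rabs_triang|]. lra.
  - now apply continuous_log_kernel.
Qed.

(* [tower k (S m)] is the generating function of the series [arg_mk m k]; the
   substitution [- x] makes [tower k (S m)' = - tower k m / (1 + x)] hold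
   uniformly in [m]. *)
Definition tower (k m : nat) (x : R) : R :=
  PSeries (coef (repeat 1%Z m ++ (-1)%Z :: (-1)%Z :: repeat 1%Z k)) (- x).

Lemma unit_entries_tower (k m : nat) :
  unit_entries (repeat 1%Z m ++ (-1)%Z :: (-1)%Z :: repeat 1%Z k).
Proof.
  induction m as [|m IH]; simpl.
  - constructor; [auto|]. constructor; [auto|]. apply unit_entries_ones.
  - constructor; auto.
Qed.

Lemma PSeries_coef_arg_mk (m k : nat) (x : R) :
  PSeries (coef (arg_mk m k)) x = tower k (S m) x.
Proof. apply PSeries_coef_bar. Qed.

Lemma tower_0 (k m : nat) : tower k m 0 = 0.
Proof.
  unfold tower. rewrite Ropp_0. destruct m; apply PSeries_coef_cons_0.
Qed.

Lemma is_derive_tower_S (k m : nat) (x : R) :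
  Rabs x < 1 -> is_derive (tower k (S m)) x (- tower k m x / (1 + x)).
Proof. intros Hx. apply is_derive_coef_one_opp; [apply unit_entries_tower|exact Hx]. Qed.

Lemma is_derive_ln_1_plus (x : R) :
  Rabs x < 1 -> is_derive (fun y => ln (1 + y)) x (/ (1 + x)).
Proof. intros Hx. apply Rabs_def2 in Hx. auto_derive; [lra|]. field. lra. Qed.

(** At the bottom of the tower the leading [-1] cancels the substitution [- x], hence the
    denominator [1 - x]. The remaining leading [-1] turns the all-ones series into a power of
    [- ln (1 + x)]. *)
Lemma is_derive_tower_O (k : nat) (x : R) :
  Rabs x < 1 ->
  is_derive (tower k 0) x ((- ln (1 + x)) ^ S k / INR (fact (S k)) / (1 - x)).
Proof.
  intros Hx.
  assert (Hu : unit_entries ((-1)%Z :: repeat 1%Z k))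
    by (constructor; [auto|apply unit_entries_ones]).
  apply (is_derive_ext (PSeries (coef (1%Z :: (-1)%Z :: repeat 1%Z k)))).
  { intros y. unfold tower; simpl app. now rewrite PSeries_coef_bar, Ropp_involutive. }
  replace ((- ln (1 + x)) ^ S k / INR (fact (S k)))
    with (PSeries (coef ((-1)%Z :: repeat 1%Z k)) x);
    [now apply is_derive_coef_one|].
  rewrite PSeries_coef_bar. change (1%Z :: repeat 1%Z k) with (repeat 1%Z (S k)).
  rewrite PSeries_coef_ones by now rewrite Rabs_Ropp.
  unfold Rminus. now rewrite Ropp_involutive.
Qed.

(** This is integration by parts: [1 / (1 - x)] is integrated to [- ln (1 - x)], and the power of
    [ln (1 + x)] is differentiated. *)
Lemma tower_O_eq (k : nat) (x : R) :
  Rabs x < 1 ->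
  tower k 0 x = (-1) ^ S k / INR (fact (S k)) *
    (INR (S k) * RInt (log_kernel k) 0 x - ln (1 + x) ^ S k * ln (1 - x)).
Proof.
  apply (eq_of_is_derive_unit (tower k 0)
    (fun x => (-1) ^ S k / INR (fact (S k)) *
      (INR (S k) * RInt (log_kernel k) 0 x - ln (1 + x) ^ S k * ln (1 - x)))
    (fun x => (- ln (1 + x)) ^ S k / INR (fact (S k)) / (1 - x))).
  - intros y Hy. now apply is_derive_tower_O.
  - intros y Hy.
    assert (HI := is_derive_scal _ y (INR (S k)) _ (is_derive_RInt_log_kernel k y Hy)).
    assert (Hp := is_derive_pow _ (S k) y _ (is_derive_ln_1_plus y Hy)).
    assert (Hl : is_derive (fun y => ln (1 - y)) y (- / (1 - y))).
    { apply Rabs_def2 in Hy. auto_derive; [lra|]. field. lra. }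
    assert (Hm := is_derive_mult _ _ y _ _ Hp Hl Rmult_comm).
    assert (H := is_derive_scal _ y ((-1) ^ S k / INR (fact (S k))) _ (is_derive_minus _ _ y _ _ HI Hm)).
    evar_last; [exact H|].
    unfold minus, plus, opp, mult, log_kernel; simpl AbelianGroup.sort; cbn -[INR pow fact].
    replace (- ln (1 + y)) with (-1 * ln (1 + y)) by ring.
    rewrite Rpow_mult_distr.
    apply Rabs_def2 in Hy.
    assert (Hf := INR_fact_neq_0 (S k)).
    simpl pow. field. repeat split; lra.
  - rewrite tower_0, RInt_point, Rplus_0_r, ln_1. unfold zero; simpl. ring.
Qed.

Definition tower_sum (k m : nat) (x : R) : R :=
  sum_n (fun i => ln (1 + x) ^ i / INR (fact i) * tower k (S (m - i)) x) m.

Lemma is_derive_tower_sum (k m : nat) (x : R) :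
  Rabs x < 1 ->
  is_derive (tower_sum k m) x (- (ln (1 + x) ^ m / INR (fact m) * tower k 0 x / (1 + x))).
Proof.
  intros Hx. set (u := ln (1 + x)).
  (* The derivative of the [i]-th summand by the product rule: the first part differentiates the
     power of the logarithm, the second the tower. *)
  set (d := fun i => match i with
    | O => 0
    | S j => u ^ j / INR (fact j) * / (1 + x)
    end * tower k (S (m - i)) x - u ^ i / INR (fact i) * (tower k (m - i) x / (1 + x))).
  (* The first part of [d (S n)] cancels the second part of [d n], so only the second part of the
     last term survives. The bound [n <= m] keeps the truncated subtraction exact. *)
  assert (Hsum : forall n, (n <= m)%nat ->
    sum_n d n = - (u ^ n / INR (fact n) * tower k (m - n) x / (1 + x)) :> R).
  { intros n; induction n as [|n IH]; intros Hn.
    - rewrite sum_O. unfold d, Rdiv. rewrite Nat.sub_0_r. simpl. ring.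
    - rewrite sum_Sn, IH by lia. unfold plus, d; simpl AbelianMonoid.sort.
      replace (S (m - S n)) with (m - n)%nat by lia. unfold Rdiv; cbn -[fact INR pow]. ring. }
  replace (- (u ^ m / INR (fact m) * tower k 0 x / (1 + x))) with (sum_n d m).
  2:{ now rewrite Hsum, Nat.sub_diag by lia. }
  apply (is_derive_sum_n (fun i y => ln (1 + y) ^ i / INR (fact i) * tower k (S (m - i)) y)).
  intros i Hi.
  assert (Hi' : is_derive (fun y => ln (1 + y) ^ i / INR (fact i)) x
    (match i with O => 0 | S j => u ^ j / INR (fact j) * / (1 + x) end)).
  { destruct i as [|j].
    - apply (is_derive_ext (fun _ => 1)); [intros y; simpl; field|].
      auto_derive; trivial.
    - apply (is_derive_pow_fact (fun y => ln (1 + y))), is_derive_ln_1_plus, Hx. }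
  evar_last.
  - exact (is_derive_mult _ _ x _ _ Hi' (is_derive_tower_S k (m - i) x Hx) Rmult_comm).
  - unfold d, plus, mult; cbn -[INR pow fact]. fold u. unfold Rdiv. ring.
Qed.

(* The logarithmic singularities of the two integrals at [x = 1] cancel, so
   that the identity passes to the limit term by term. *)
Lemma tower_sum_eq (k m : nat) (x : R) :
  Rabs x < 1 ->
  tower_sum k m x = (-1) ^ k / (INR (fact (S m)) * INR (fact (S k))) *
    (INR (S k) * ln (1 + x) ^ S m * RInt (log_kernel k) 0 x
     - INR (m + k + 2) * RInt (log_kernel (m + k + 1)) 0 x).
Proof.
  apply (eq_of_is_derive_unit (tower_sum k m)
    (fun x => (-1) ^ k / (INR (fact (S m)) * INR (fact (S k))) *
    (INR (S k) * ln (1 + x) ^ S m * RInt (log_kernel k) 0 x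
     - INR (m + k + 2) * RInt (log_kernel (m + k + 1)) 0 x))
    (fun x => - (ln (1 + x) ^ m / INR (fact m) * tower k 0 x / (1 + x)))).
  - intros y Hy. now apply is_derive_tower_sum.
  - intros y Hy. rewrite tower_O_eq by exact Hy.
    assert (HI := is_derive_RInt_log_kernel k y Hy).
    assert (HJ := is_derive_scal _ y (INR (m + k + 2)) _
      (is_derive_RInt_log_kernel (m + k + 1) y Hy)).
    assert (Hp := is_derive_scal _ y (INR (S k)) _
      (is_derive_pow _ (S m) y _ (is_derive_ln_1_plus y Hy))).
    assert (Hm := is_derive_mult _ _ y _ _ Hp HI Rmult_comm).
    evar_last;
      [exact (is_derive_scal _ y ((-1) ^ k / (INR (fact (S m)) * INR (fact (S k)))) _
        (is_derive_minus _ _ y _ _ Hm HJ))|].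
    unfold minus, plus, opp, mult, log_kernel; cbn -[INR pow fact RInt Nat.add].
    apply Rabs_def2 in Hy.
    assert (Hf := INR_fact_neq_0 (S k)). assert (Hg := INR_fact_neq_0 m).
    assert (Hm0 : INR (S m) <> 0) by (apply not_0_INR; lia).
    rewrite (INR_fact_S m).
    (* The terms in [u ^ (m + k + 1) * ln (1 - y) / (1 + y)] have coefficients [k + 1] and
       [- (m + k + 2)]. Their sum [- (m + 1)] matches the boundary term of [tower_O_eq]. *)
    replace (ln (1 + y) ^ (m + k + 1)) with (ln (1 + y) ^ m * ln (1 + y) ^ S k)
      by (rewrite <- pow_add; f_equal; lia).
    replace (INR (m + k + 2)) with (INR (S m) + INR (S k))
      by (rewrite <- plus_INR; f_equal; lia).
    set (u := ln (1 + y)) in *.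
    rewrite <- !tech_pow_Rmult.
    field. repeat split; try assumption; lra.
  - rewrite !RInt_point, Rplus_0_r, ln_1. unfold zero; simpl AbelianGroup.sort.
    transitivity 0.
    + unfold tower_sum. rewrite (sum_n_ext _ (fun _ => 0)), sum_n_const.
      * apply Rmult_0_r.
      * intros i. rewrite tower_0. apply Rmult_0_r.
    + cbn -[INR pow fact RInt Nat.add]. ring.
Qed.

Lemma unit_entries_minus_one : unit_entries ((-1)%Z :: nil).
Proof. constructor; [auto|constructor]. Qed.

(** The derivative of the right-hand side is [- F_(1)(x) / (1 + x)] with [F_(1)(x) = - ln (1 - x)].
    This links the integral for [k = 0] to the double series. *)
Lemma RInt_log_kernel_0 (x : R) :
  Rabs x < 1 -> RInt (log_kernel 0) 0 x = PSeries (coef ((-1)%Z :: (-1)%Z :: nil)) x.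
Proof.
  apply (eq_of_is_derive_unit _ _ (log_kernel 0)).
  - intros y Hy. now apply is_derive_RInt_log_kernel.
  - intros y Hy. evar_last; [now apply is_derive_coef_bar; [apply unit_entries_minus_one|]|].
    rewrite PSeries_coef_bar, Ropp_involutive.
    rewrite (PSeries_coef_ones 1) by exact Hy. unfold log_kernel. simpl.
    apply Rabs_def2 in Hy. field. lra.
  - now rewrite RInt_point, PSeries_coef_cons_0.
Qed.

(** * Limits as x tends to 1 from the left *)

Lemma filterlim_Rplus {T : Type} {F : (T -> Prop) -> Prop} {FF : Filter F}
  (f g : T -> R) (a b : R) :
  filterlim f F (locally a) -> filterlim g F (locally b) ->
  filterlim (fun x => f x + g x) F (locally (a + b)).
Proof.
  intros Hf Hg. eapply filterlim_comp_2; [exact Hf|exact Hg|].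
  apply (filterlim_plus (V := R_NormedModule)).
Qed.

Lemma filterlim_Rmult {T : Type} {F : (T -> Prop) -> Prop} {FF : Filter F}
  (f g : T -> R) (a b : R) :
  filterlim f F (locally a) -> filterlim g F (locally b) ->
  filterlim (fun x => f x * g x) F (locally (a * b)).
Proof.
  intros Hf Hg. eapply filterlim_comp_2; [exact Hf|exact Hg|].
  apply (filterlim_mult (K := R_AbsRing)).
Qed.

Lemma filterlim_Rminus {T : Type} {F : (T -> Prop) -> Prop} {FF : Filter F}
  (f g : T -> R) (a b : R) :
  filterlim f F (locally a) -> filterlim g F (locally b) ->
  filterlim (fun x => f x - g x) F (locally (a - b)).
Proof.
  intros Hf Hg.
  apply (filterlim_ext (fun x => f x + (-1) * g x)); [intros x; ring|].
  replace (a - b) with (a + (-1) * b) by ring.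
  apply filterlim_Rplus; [exact Hf|].
  apply filterlim_Rmult; [apply filterlim_const|exact Hg].
Qed.

Lemma filterlim_Rpow {T : Type} {F : (T -> Prop) -> Prop} {FF : Filter F}
  (f : T -> R) (a : R) (n : nat) :
  filterlim f F (locally a) -> filterlim (fun x => f x ^ n) F (locally (a ^ n)).
Proof.
  intros Hf. induction n as [|n IH]; simpl; [apply filterlim_const|].
  now apply filterlim_Rmult.
Qed.

Lemma filterlim_sum_n {T : Type} {F : (T -> Prop) -> Prop} {FF : Filter F}
  (f : nat -> T -> R) (l : nat -> R) (n : nat) :
  (forall i, filterlim (f i) F (locally (l i))) ->
  filterlim (fun x => sum_n (fun i => f i x) n) F (locally (sum_n l n)).
Proof.
  intros Hf. induction n as [|n IH].
  - rewrite sum_O. eapply filterlim_ext; [|apply Hf]. intros x. now rewrite sum_O.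
  - rewrite sum_Sn. eapply filterlim_ext; [|apply filterlim_Rplus; [apply IH|apply Hf]].
    intros x. now rewrite sum_Sn.
Qed.

Lemma at_left_1_unit : at_left 1 (fun x => Rabs x < 1).
Proof.
  exists (mkposreal 1 Rlt_0_1). intros y Hy Hy1.
  unfold ball in Hy; simpl in Hy; unfold AbsRing_ball, abs, minus, plus, opp in Hy; simpl in Hy.
  apply Rabs_def2 in Hy. apply Rabs_def1; lra.
Qed.

(** The lower endpoint is fixed by [at_point 0], so the limit along the product filter reduces to
    one in the upper endpoint. *)
Lemma RInt_gen_at_left_1 (f : R -> R) (l : R) :
  (forall x, Rabs x < 1 -> ex_RInt f 0 x) ->
  filterlim (RInt f 0) (at_left 1) (locally l) ->
  RInt_gen f (at_point 0) (at_left 1) = l.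
Proof.
  intros Hex Hl.
  apply (@is_RInt_gen_unique R_CompleteNormedModule); try typeclasses eauto.
  intros P HP.
  apply (Filter_prod _ _ _ (fun x => x = 0) (fun y => P (RInt f 0 y) /\ Rabs y < 1)).
  - reflexivity.
  - apply filter_and; [now apply Hl|exact at_left_1_unit].
  - intros x y -> [HPy Hy]. exists (RInt f 0 y). split; [|exact HPy].
    now apply (@RInt_correct R_CompleteNormedModule), Hex.
Qed.

Lemma filterlim_ln_1_plus :
  filterlim (fun x => ln (1 + x)) (at_left 1) (locally (ln 2)).
Proof.
  eapply filterlim_filter_le_1; [apply filter_le_within|].
  replace 2 with (1 + 1) by ring.
  apply (ex_derive_continuous (fun x => ln (1 + x))). auto_derive. lra.
Qed.

Lemma mzv_minus_one : mzv ((-1)%Z :: nil) = - ln 2.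
Proof.
  apply (filterlim_locally_unique (F := at_left 1) (PSeries (coef ((-1)%Z :: nil)))).
  - apply PSeries_coef_bar_at_left_1. constructor.
  - apply (filterlim_ext_loc (fun x => 0 - ln (1 + x))).
    + eapply filter_imp; [|exact at_left_1_unit]. intros x Hx.
      rewrite PSeries_coef_bar. rewrite (PSeries_coef_ones 1) by now rewrite Rabs_Ropp.
      unfold Rminus. rewrite Ropp_involutive. simpl. field.
    + replace (- ln 2) with (0 - ln 2) by ring.
      apply filterlim_Rminus; [apply filterlim_const|apply filterlim_ln_1_plus].
Qed.

(** * The stuffle relation and the constant I(0) *)

Lemma mzv_trunc_cons_S (z : Z) (t : list Z) (N : nat) :
  mzv_trunc (z :: t) (S N) = mzv_trunc (z :: t) N + mzv_term z (S N) * mzv_trunc t N.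
Proof. rewrite <- !(sum_n_coef (z :: t)), sum_Sn. reflexivity. Qed.

Lemma mzv_term_minus_one_sqr (n : nat) : mzv_term (-1) (S n) ^ 2 = mzv_term 2 (S n).
Proof.
  rewrite mzv_term_minus_one.
  change (mzv_term 2 (S n)) with (1 / INR (S n) ^ 2).
  replace (((-1) ^ S n / INR (S n)) ^ 2)
    with (((-1) ^ S n * (-1) ^ S n) / INR (S n) ^ 2)
    by (field; apply not_0_INR; lia).
  rewrite <- Rpow_mult_distr. replace (-1 * -1) with 1 by ring. now rewrite pow1.
Qed.

(** The square is a double sum over [n_1] and [n_2]: the two triangles are equal by symmetry, and on
    the diagonal the signs square to [1]. *)
Lemma mzv_trunc_stuffle (N : nat) :
  mzv_trunc ((-1)%Z :: nil) N ^ 2 =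
  2 * mzv_trunc ((-1)%Z :: (-1)%Z :: nil) N + mzv_trunc (2%Z :: nil) N.
Proof.
  induction N as [|N IH].
  - rewrite <- !sum_n_coef, !sum_O. simpl. ring.
  - rewrite !mzv_trunc_cons_S, <- mzv_term_minus_one_sqr.
    change (mzv_trunc nil N) with 1.
    set (A := mzv_trunc ((-1)%Z :: nil) N) in *.
    set (e := mzv_term (-1) (S N)).
    replace ((A + e * 1) ^ 2) with (A ^ 2 + 2 * A * e + e ^ 2) by ring.
    rewrite IH. ring.
Qed.

Lemma mzv_bar_one_bar_one : mzv ((-1)%Z :: (-1)%Z :: nil) = Iint 0.
Proof.
  (* Convergence of the series for [zeta2] is obtained from the stuffle relation itself, whose other
     two terms converge. *)
  assert (H2 : is_lim_seq (mzv_trunc (2%Z :: nil))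
    ((- ln 2) ^ 2 - 2 * mzv ((-1)%Z :: (-1)%Z :: nil))).
  { apply (is_lim_seq_ext (fun N => mzv_trunc ((-1)%Z :: nil) N ^ 2
      - 2 * mzv_trunc ((-1)%Z :: (-1)%Z :: nil) N)).
    - intros N. rewrite mzv_trunc_stuffle. ring.
    - assert (H1 := is_lim_seq_mzv_trunc_bar nil (List.Forall_nil _)).
      assert (H11 := is_lim_seq_mzv_trunc_bar _ unit_entries_minus_one).
      rewrite mzv_minus_one in H1.
      apply filterlim_Rminus.
      + now apply filterlim_Rpow.
      + apply filterlim_Rmult; [apply filterlim_const|exact H11]. }
  assert (Hz : zeta2 = (- ln 2) ^ 2 - 2 * mzv ((-1)%Z :: (-1)%Z :: nil)).
  { exact (f_equal real (is_lim_seq_unique _ _ H2)). }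
  unfold Iint. rewrite Hz. field.
Qed.

(** * Passage to the limit in the identity *)

Lemma tower_at_left_1 (k m : nat) :
  filterlim (tower k (S m)) (at_left 1) (locally (mzv (arg_mk m k))).
Proof.
  apply (filterlim_ext (PSeries (coef (arg_mk m k)))); [apply PSeries_coef_arg_mk|].
  apply PSeries_coef_bar_at_left_1, unit_entries_tower.
Qed.

(* Convergence of the improper integral for [k + 1] is read off from
   [tower_sum_eq] with [m = 0], whose left-hand side converges by Abel's theorem. *)
Lemma RInt_log_kernel_at_left_1 (k : nat) :
  filterlim (RInt (log_kernel k) 0) (at_left 1) (locally (Iint k)).
Proof.
  induction k as [|k IH].
  - rewrite <- mzv_bar_one_bar_one.
    apply (filterlim_ext_loc (PSeries (coef ((-1)%Z :: (-1)%Z :: nil)))).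
    + eapply filter_imp; [|exact at_left_1_unit]. intros x Hx.
      now rewrite RInt_log_kernel_0.
    + apply PSeries_coef_bar_at_left_1, unit_entries_minus_one.
  - assert (Hc : exists l, filterlim (RInt (log_kernel (S k)) 0) (at_left 1) (locally l)).
    { set (c := (-1) ^ k / (INR (fact 1) * INR (fact (S k)))).
      assert (Hc : c <> 0).
      { unfold c. apply Rmult_integral_contrapositive. split.
        - apply pow_nonzero. lra.
        - apply Rinv_neq_0_compat, Rmult_integral_contrapositive.
          split; apply INR_fact_neq_0. }
      assert (Hk : INR (0 + k + 2) <> 0) by (apply not_0_INR; lia).
      eexists.
      apply (filterlim_ext_loc (fun x =>
        (INR (S k) * ln (1 + x) ^ 1 * RInt (log_kernel k) 0 x - / c * tower k 1 x)
        * / INR (0 + k + 2))).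
      - eapply filter_imp; [|exact at_left_1_unit]. intros x Hx.
        assert (H := tower_sum_eq k 0 x Hx).
        unfold tower_sum in H. rewrite sum_O in H. fold c in H.
        replace (0 + k + 1)%nat with (S k) in H by lia.
        replace (ln (1 + x) ^ 0 / INR (fact 0) * tower k (S (0 - 0)) x)
          with (tower k 1 x) in H by (simpl; field).
        rewrite H. field. now split.
      - apply filterlim_Rmult; [|apply filterlim_const].
        apply filterlim_Rminus; [|apply filterlim_Rmult;
          [apply filterlim_const|apply tower_at_left_1]].
        apply filterlim_Rmult; [|exact IH].
        apply filterlim_Rmult; [apply filterlim_const|].
        apply filterlim_Rpow, filterlim_ln_1_plus. }
    destruct Hc as [l Hl].
    (* For a positive index [Iint] is the improper integral, so it equals the limit whose existence
       was just shown. *)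
    replace (Iint (S k)) with l; [exact Hl|]. symmetry.
    now apply RInt_gen_at_left_1; [apply ex_RInt_log_kernel|].
Qed.

Theorem theorem3p5 (m k : nat) :
  mzv (arg_mk m k) =
    (-1) ^ k / (INR (fact (m + 1)) * INR (fact (k + 1))) *
      (INR (k + 1) * ln 2 ^ (m + 1) * Iint k
       - INR (m + k + 2) * Iint (m + k + 1))
    - sum_n_m (fun i => ln 2 ^ i / INR (fact i) * mzv (arg_mk (m - i) k)) 1 m.
Proof.
  set (f := fun i => ln 2 ^ i / INR (fact i) * mzv (arg_mk (m - i) k)).
  (* The left-hand side of the theorem is the missing term [i = 0] of the sum, so the claim becomes
     a formula for the full sum. *)
  assert (Hsum : sum_n f m = mzv (arg_mk m k) + sum_n_m f 1 m).
  { unfold sum_n. rewrite sum_Sn_m by lia. unfold plus; simpl AbelianMonoid.sort.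
    unfold f at 1. rewrite Nat.sub_0_r. simpl. field. }
  rewrite !(Nat.add_1_r m), !(Nat.add_1_r k).
  enough (H : sum_n f m = (-1) ^ k / (INR (fact (S m)) * INR (fact (S k))) *
      (INR (S k) * ln 2 ^ S m * Iint k - INR (m + k + 2) * Iint (m + k + 1))) by lra.
  (* Both sides are limits of [tower_sum k m] at 1, one taken summand by summand and the other
     through [tower_sum_eq]. *)
  apply (filterlim_locally_unique (F := at_left 1) (tower_sum k m)).
  - apply (filterlim_sum_n
      (fun i x => ln (1 + x) ^ i / INR (fact i) * tower k (S (m - i)) x)).
    intros i. apply filterlim_Rmult; [|apply tower_at_left_1].
    apply filterlim_Rmult; [|apply filterlim_const].
    apply filterlim_Rpow, filterlim_ln_1_plus.
  - eapply filterlim_ext_loc.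
    + eapply filter_imp; [|exact at_left_1_unit]. intros x Hx.
      symmetry. now apply tower_sum_eq.
    + apply filterlim_Rmult; [apply filterlim_const|].
      apply filterlim_Rminus; (apply filterlim_Rmult; [|apply RInt_log_kernel_at_left_1]);
        [|apply filterlim_const].
      apply filterlim_Rmult; [apply filterlim_const|].
      apply filterlim_Rpow, filterlim_ln_1_plus.
Qed.
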